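(* Let $X$ be a compact metric space and let $f_n:X\to X$ be a continuous surjective map for each $n\ge0$; put $f_{0,\infty}=\{f_n\}_{n=0}^\infty$. If $(X,f_{0,\infty})$ is not mixing, then $(\mathcal{M}(X),\hat f_{0,\infty})$ does not have the shadowing property.
   Context: Let $(X,d)$ be a compact metric space. A non-autonomous dynamical system $(X,f_{0,\infty})$ is given by a sequence $f_{0,\infty}=\{f_n\}_{n=0}^\infty$ of continuous self-maps of $X$; write $f_0^n=f_{n-1}\circ\cdots\circ f_0$ for $n\ge1$ and $f_0^0=\mathrm{id}$. $\mathcal{M}(X)$ is the space of all Borel probability measures on $X$ with the Prohorov metric $\mathcal{P}_d(\mu,\nu)=\inf\{\epsilon>0:\mu(A)\le\nu(A^\epsilon)+\epsilon \text{ and } \nu(A)\le\mu(A^\epsilon)+\epsilon \text{ for all Borel } A\subset X\}$, where $A^\epsilon=\{x\in X: d(x,A)<\epsilon\}$; its topology is the weak$^*$-topology and $\mathcal{M}(X)$ is a compact metric space. The induced system $(\mathcal{M}(X),\hat f_{0,\infty})$, $\hat f_{0,\infty}=\{\hat f_n\}_{n=0}^\infty$, consists of the continuous maps $\hat f_n(\mu)(A)=\mu(f_n^{-1}(A))$. $(X,f_{0,\infty})$ is mixing if for any nonempty open $U,V\subset X$ there is $N_0\ge1$ such that $f_0^n(U)\cap V\ne\emptyset$ for all $n\ge N_0$. A $\delta$-pseudo orbit is a finite or infinite sequence $\{x_0,x_1,\dots\}$ with $d(f_n(x_n),x_{n+1})<\delta$ for all $n=0,1,\dots$ for which $x_{n+1}$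 is defined. $(X,f_{0,\infty})$ has the shadowing property if for every $\varepsilon>0$ there is $\delta>0$ such that every $\delta$-pseudo orbit $\{x_0,x_1,\dots\}$ is $\varepsilon$-shadowed by some $y\in X$, i.e. $d(f_0^n(y),x_n)<\varepsilon$ for all indices $n$ of the pseudo orbit. For $\mathcal{M}(X)$ the metric used is $\mathcal{P}_d$. *)

(* Defs.v *)
From HB Require Import structures.
From mathcomp Require Import all_boot all_order all_algebra.
From mathcomp Require Import all_classical all_reals all_analysis.

Set Implicit Arguments.
Unset Strict Implicit.
Unset Printing Implicit Defensive.

Import Order.TTheory GRing.Theory Num.Theory.
Import numFieldNormedType.Exports.

Local Open Scope classical_set_scope.
Local Open Scope ring_scope.

(* Metric spaces with a distinguished point, i.e. nonempty metric spaces: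
   measurable types, hence Borel measures, require the carrier to be pointed. *)
#[short(type="pmetricType")]
HB.structure Definition PointedMetric (K : numDomainType) :=
  { M of Metric K M & Pointed M }.

Definition nds_comp (T : Type) (f : nat -> T -> T) : nat -> T -> T :=
  fix comp n := if n is m.+1 then f m \o comp m else id.

Definition mixing (X : topologicalType) (f : nat -> X -> X) : Prop :=
  forall U V : set X, open U -> open V -> U !=set0 -> V !=set0 ->
  exists N0 : nat, (1 <= N0)%N /\
    forall n, (N0 <= n)%N -> (nds_comp f n @` U) `&` V !=set0.

Section shadowing_property.
Variables (R : realType) (T : Type) (d : T -> T -> R) (f : nat -> T -> T).

(* A sequence x : nat -> T together with N : option nat encodes the finite
   sequence x 0, ..., x m when N = Some m and the infinite one when N = None;
   values of x outside the index range are irrelevant. *)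
Definition seq_index (N : option nat) (n : nat) : bool :=
  if N is Some m then (n <= m)%N else true.

Definition pseudo_orbit (delta : R) (N : option nat) (x : nat -> T) : Prop :=
  forall n, seq_index N n.+1 -> d (f n (x n)) (x n.+1) < delta.

Definition shadowed_by (eps : R) (N : option nat) (x : nat -> T) (y : T)
    : Prop :=
  forall n, seq_index N n -> d (nds_comp f n y) (x n) < eps.

Definition shadowing_property : Prop :=
  forall eps : R, 0 < eps ->
  exists2 delta : R, 0 < delta &
    forall (N : option nat) (x : nat -> T), pseudo_orbit delta N x ->
    exists y : T, shadowed_by eps N x y.

End shadowing_property.

Notation borel X := (g_sigma_algebraType (@open X)).

(* A measure in the library is a function on all subsets, constrained only on
   the measurable ones, so a point of the space of Borel probability measures
   is represented by any mu : borel_probability X with the given values on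
   Borel sets.  The definitions below depend on these values only. *)
Definition borel_probability (R : realType) (X : pmetricType R) : Type :=
  probability (borel X) R.

Section prohorov.
Variables (R : realType) (X : pmetricType R).

(* d(x, A), with the convention d(x, set0) = +oo. *)
Definition dist_set (x : X) (A : set X) : \bar R :=
  ereal_inf [set (mdist x a)%:E | a in A].

Definition enlarge (A : set X) (eps : R) : set X :=
  [set x | (dist_set x A < eps%:E)%E].

Definition prohorov (mu nu : borel_probability X) : R :=
  inf [set eps : R | 0 < eps /\
    forall A : set (borel X), measurable A ->
      (mu A <= nu (enlarge A eps) + eps%:E)%E /\
      (nu A <= mu (enlarge A eps) + eps%:E)%E].

End prohorov.

Section induced_map.
Variables (R : realType) (X : pmetricType R) (f : X -> X).
Variable cf : continuous f.

Definition borel_fun of continuous f : borel X -> borel X := f.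

Lemma measurable_borel_fun : measurable_fun [set: borel X] (borel_fun cf).
Proof.
refine (@measurability _ _ (borel X) (borel X) setT (borel_fun cf)
  (@open X) _ _) => // _ [B oB <-].
rewrite setTI; apply: sub_sigma_algebra.
by move/continuousP: cf; apply.
Qed.

HB.instance Definition _ :=
  isMeasurableFun.Build _ _ _ _ (borel_fun cf) measurable_borel_fun.

Definition induced_map (mu : borel_probability X) : borel_probability X :=
  distribution mu (borel_fun cf).

Lemma induced_mapE (mu : borel_probability X) (A : set (borel X)) :
  induced_map mu A = mu (f @^-1` A).
Proof. by []. Qed.

End induced_map.

(* Main.v *)
(* Shadowing of the induced system forces mixing.  Given u in U and v in V, pick
   by surjectivity w with f_0^n(w) = v.  Sliding the weight from the orbit of u
   to the orbit of w in K steps of size 1/K < delta gives a delta-pseudo orbit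
   from the Dirac mass at u to the Dirac mass at v as soon as n >= K, K not
   depending on w.  A measure nu shadowing it gives both U and the preimage of V
   under f_0^n mass greater than 1/2, hence these sets meet. *)

Require Import Defs.
From HB Require Import structures.
From mathcomp Require Import all_boot all_order all_algebra.
From mathcomp Require Import all_classical all_reals all_analysis.
From mathcomp Require Import lra.

Set Implicit Arguments.
Unset Strict Implicit.
Unset Printing Implicit Defensive.

Import Order.TTheory GRing.Theory Num.Theory.
Import numFieldNormedType.Exports.

Local Open Scope classical_set_scope.
Local Open Scope ring_scope.

Definition two_point_fun (R : realType) (X : pmetricType R) (x y : X) :
  bool -> borel X := fun b => if b then x else y.

HB.instance Definition _ (R : realType) (X : pmetricType R) (x y : X) :=
  isMeasurableFun.Build _ _ _ _ (two_point_fun x y) (fun _ _ _ => I).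

(** The convex combination p δ_x + (1 - p) δ_y, built as the image of a Bernoulli law so that it is
    a probability measure by construction. *)
Definition two_point (R : realType) (X : pmetricType R) (p : R) (x y : X) :
    borel_probability X :=
  distribution (bernoulli_prob p) (two_point_fun x y).

(** Holds for every set [A], Borel or not, so it evaluates enlargements without any proof that they
    are measurable. *)
Lemma two_pointE (R : realType) (X : pmetricType R) (p : R) (x y : X)
    (A : set X) : 0 <= p <= 1 ->
  two_point p x y A = (p * \1_A x + (1 - p) * \1_A y)%:E.
Proof.
move=> /andP[p0 p1].
rewrite /two_point /distribution/= /pushforward (@bernoulli_dirac _ _ p0)//.
by rewrite measure_addE/= /mscale/= !diracE/=.
Qed.

Lemma enlargeE (R : realType) (X : pmetricType R) (A : set X) (e : R) :
  enlarge A e = [set x | exists2 a, A a & mdist x a < e].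
Proof.
apply/seteqP; split=> x /=; rewrite /enlarge /dist_set/=.
  by move=> /ereal_inf_lt[_ [a Aa <-]]; rewrite lte_fin => xa; exists a.
move=> [a Aa xa]; apply: (@le_lt_trans _ _ (mdist x a)%:E); last first.
  by rewrite lte_fin.
by apply: ereal_inf_lbound; exists a.
Qed.

Lemma sub_enlarge (R : realType) (X : pmetricType R) (A : set X) (e : R) :
  0 < e -> A `<=` enlarge A e.
Proof. by move=> e0 x Ax; rewrite enlargeE; exists x => //; rewrite mdistxx. Qed.

Lemma prohorov_lt (R : realType) (X : pmetricType R)
    (mu nu : borel_probability X) (e : R) : prohorov mu nu < e ->
  exists2 c, c < e & forall A : set (borel X), measurable A ->
    (mu A <= nu (enlarge A c) + c%:E)%E.
Proof.
move=> /inf_lt; case.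
  (* The set under the infimum is inhabited: 1 qualifies because probabilities are at most 1. *)
  exists 1; split=> // A mA.
  by split; rewrite (le_trans (probability_le1 _ mA))// leeDr.
by move=> c [c0 H] ce; exists c => // A /H[].
Qed.

Lemma prohorov_le (R : realType) (X : pmetricType R)
    (mu nu : borel_probability X) (e : R) : 0 < e ->
  (forall A : set X, (mu A <= nu (enlarge A e) + e%:E)%E) ->
  (forall A : set X, (nu A <= mu (enlarge A e) + e%:E)%E) ->
  prohorov mu nu <= e.
Proof.
move=> e0 H1 H2; apply: ge_inf; last by split=> // A _; split.
by exists 0 => c /= [/ltW].
Qed.

(** Both measures live on the points [f x] and [f y], so only the weights have to be compared; no
    mass moves in space. *)
Lemma prohorov_two_point (R : realType) (X : pmetricType R) (f : X -> X)
    (cf : continuous f) (p q e : R) (x y : X) :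
  0 <= p <= 1 -> 0 <= q <= 1 -> 0 < e -> `|p - q| <= e ->
  prohorov (induced_map cf (two_point p x y)) (two_point q (f x) (f y)) <= e.
Proof.
move=> p01 q01 e0; rewrite ler_norml => /andP[pq1 pq2].
have ind (A : set X) z :
    0 <= (\1_A z : R) /\ (\1_A z : R) <= (\1_(enlarge A e) z : R) <= 1.
  rewrite !indicE ler0n; split=> //.
  have [zA|_] := boolP (z \in A); last by rewrite ler0n lern1 leq_b1.
  by rewrite (_ : z \in enlarge A e) ?lexx//;
    apply/mem_set/(sub_enlarge e0)/set_mem.
(* After replacing [A] by its enlargement, with indicators a, b at [f x], [f y], the two masses
   differ by (p - q)(a - b) up to sign, which is at most |p - q| since a and b lie in [0, 1]. *)
apply: prohorov_le => // A; rewrite induced_mapE !two_pointE// -EFinD lee_fin;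
  have := ind A (f x); have := ind A (f y);
  rewrite -![\1_(f @^-1` _) _]/(\1__ (f _) : R);
  move=> [? /andP[? ?]] [? /andP[? ?]];
  case/andP: p01 => ? ?; case/andP: q01 => ? ?; nra.
Qed.

(** For some c < e, the c-enlargement of the complement of [U] misses [x], so the Dirac mass gives
    it 0 and only the additive error c remains. *)
Lemma near_dirac_compl (R : realType) (X : pmetricType R)
    (mu nu : borel_probability X) (x : X) (U : set X) (e : R) :
  open U -> ball x e `<=` U -> (forall A : set X, nu A = (\1_A x)%:E) ->
  prohorov mu nu < e -> (mu (~` U) < e%:E)%E.
Proof.
move=> oU xU nuE /prohorov_lt[c ce /(_ (~` U))].
have mU : measurable (~` U : set (borel X)).
  by apply: measurableC; apply: sub_sigma_algebra.
move=> /(_ mU)/le_lt_trans; apply; rewrite nuE -EFinD lte_fin.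
rewrite indicE memNset ?add0r// enlargeE => -[a Ua xa].
by apply/Ua/xU; rewrite ballEmdist /=; apply: lt_trans ce.
Qed.

Lemma nds_comp_inducedE (R : realType) (X : pmetricType R) (f : nat -> X -> X)
    (cf : forall n, continuous (f n)) (mu : borel_probability X) n (A : set X) :
  nds_comp (fun n => induced_map (cf n)) n mu A = mu (nds_comp f n @^-1` A).
Proof. by elim: n A => [//|n IH] A; rewrite [LHS]IH. Qed.

Lemma nds_comp_continuous (X : topologicalType) (f : nat -> X -> X) n :
  (forall n, continuous (f n)) -> continuous (nds_comp f n).
Proof.
move=> cf; elim: n => [|n IH] x; first exact: cvg_id.
exact: continuous_comp (IH x) (cf n _).
Qed.

Lemma nds_comp_surj (T : Type) (f : nat -> T -> T) n :
  (forall n, set_surj [set: T] [set: T] (f n)) ->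
  forall v, exists w, nds_comp f n w = v.
Proof.
move=> sf; elim: n => [|n IH] v; first by exists v.
by have [w _ <-] := sf n v I; have [z <-] := IH w; exists z.
Qed.

(** The ramp is the weight already transferred at time [k]; it stays at 1 from time [K] on. *)
Lemma ramp_bounds (R : realType) (k K : nat) :
  0 <= (Num.min (k%:R / K%:R) 1 : R) <= 1.
Proof. by rewrite le_min divr_ge0//= ler01 ge_min lexx orbT. Qed.

Lemma ramp_step (R : realType) (k K : nat) :
  `|Num.min (k%:R / K%:R) 1 - Num.min (k.+1%:R / K%:R) 1| <= K%:R^-1 :> R.
Proof.
rewrite -natr1 mulrDl mul1r; set a := _ / _; set b := _^-1.
have b0 : 0 <= b by rewrite invr_ge0.
rewrite ler_norml; do 2![case: (leP _ 1) => ?]; apply/andP; split; lra.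
Qed.

Lemma shadowing_mixing (R : realType) (X : pmetricType R) (f : nat -> X -> X)
    (cf : forall n, continuous (f n)) :
  (forall n, set_surj [set: X] [set: X] (f n)) ->
  shadowing_property (@prohorov R X) (fun n => induced_map (cf n)) ->
  mixing f.
Proof.
move=> sf shad U V oU oV [u Uu] [v Vv].
have [r r0 uU] : exists2 r : R, 0 < r & ball u r `<=` U.
  by move: oU Uu; rewrite openE => /[apply] /nbhs_ballP[r r0 ?]; exists r.
have [s s0 vV] : exists2 s : R, 0 < s & ball v s `<=` V.
  by move: oV Vv; rewrite openE => /[apply] /nbhs_ballP[s s0 ?]; exists s.
(* [r] and [s] keep the [e]-balls inside [U] and [V]; the bound 1/2 makes two masses below [e] sum
   to less than 1. *)
pose e : R := Num.min (Num.min r s) 2^-1.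
have e0 : 0 < e by rewrite !lt_min r0 s0 invr_gt0/=.
have er : e <= r by rewrite !ge_min lexx.
have es : e <= s by rewrite !ge_min lexx orbT.
have e2 : e <= 2^-1 by rewrite ge_min lexx orbT.
have [d d0 {}shad] := shad e e0.
pose K := (Num.trunc d^-1).+1.
have Kd : K%:R^-1 < d.
  rewrite -[ltRHS]invrK ltf_pV2 ?posrE ?invr_gt0//.
  exact: truncnS_gt.
exists K; split=> // n Kn.
have [w wv] := nds_comp_surj n sf v.
(* [w] depends on [n], but [K] was fixed from [d] alone, hence the same [K] serves every later
   [n]. *)
pose mu k := two_point (1 - Num.min (k%:R / K%:R) 1 : R)
  (nds_comp f k u) (nds_comp f k w).
have ramp k : 0 <= (1 - Num.min (k%:R / K%:R) 1 : R) <= 1.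
  by have := ramp_bounds R k K; lra.
have [|nu nuP] := shad (Some n) mu.
  move=> k _; apply: le_lt_trans Kd; apply: prohorov_two_point => //.
    by rewrite invr_gt0 ltr0n.
  by rewrite opprB addrC addrA subrK distrC ramp_step.
have nuU : (nu (~` U) < e%:E)%E.
  apply: (near_dirac_compl oU _ _ (nuP 0 isT)) => //.
    by apply: subset_trans uU; exact: le_ball.
  by move=> A; rewrite two_pointE// mul0r min_l// subr0 subrr mul1r mul0r addr0.
have nuV : (nu (nds_comp f n @^-1` (~` V)) < e%:E)%E.
  (* This mass is that of the complement of [V] under the [n]-th image of [nu], which is close to
     the Dirac mass at [v] because the ramp is complete at [n]. *)
  rewrite -(nds_comp_inducedE cf).
  apply: (near_dirac_compl oV _ _ (nuP n (leqnn n))) => //.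
    by apply: subset_trans vV; exact: le_ball.
  move=> A; rewrite two_pointE// wv min_r; last first.
    by rewrite ler_pdivlMr// mul1r ler_nat.
  by rewrite subrr subr0 mul0r mul1r add0r.
apply: contrapT => UV0.
have mW (W : set X) : open W -> measurable (~` W : set (borel X)).
  by move=> oW; apply: measurableC; apply: sub_sigma_algebra.
(* If [U] missed the preimage of [V], the two complements would cover the space, giving 1 < 2e <=
   1. *)
have : (nu setT <= nu (~` U) + nu (nds_comp f n @^-1` (~` V)))%E.
  have mU := mW _ oU.
  have mV := mW _ (proj1 (continuousP _) (nds_comp_continuous (n:=n) cf) _ oV).
  rewrite -[X in (nu X <= _)%E](_ : ~` U `|` nds_comp f n @^-1` (~` V) = _).
    exact: measureU2.
  rewrite -subTset => x _ /=.
  apply/not_andP => -[Ux Vx]; apply: UV0.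
  by exists (nds_comp f n x); split => //; exists x.
rewrite probability_setT => /le_lt_trans/(_ (lteD nuU nuV)).
by rewrite -EFinD lte_fin; lra.
Qed.

Theorem theorem3p9 (R : realType) (X : pmetricType R) (f : nat -> X -> X)
    (compactX : compact [set: X])
    (cf : forall n, continuous (f n))
    (sf : forall n, set_surj [set: X] [set: X] (f n)) :
  ~ mixing f ->
  ~ shadowing_property (@prohorov R X) (fun n => induced_map (cf n)).
Proof. by move=> nmix /(shadowing_mixing sf). Qed.
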